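(* For the bipyramid $B_5$ (on 7 vertices), there exists a generic framework $(B_5,\mathbf p)$ in $\mathbb R^2$ that is rigid and globally rigid, and there exists a generic framework $(B_5,\mathbf p')$ in $\mathbb R^2$ that is rigid but not globally rigid.
   Context: For a configuration $\mathbf p=(\mathbf p(1),\dots,\mathbf p(n))\in(\mathbb R^2)^n$ and a triple $\sigma=i_1i_2i_3$ with $1\le i_1<i_2<i_3\le n$, let $C(\sigma,\mathbf p)$ be the $3\times 3$ matrix whose $k$-th column is $(1,\mathbf p(i_k))^T$. A framework $(\Sigma,\mathbf p)$ is a pure 2-dimensional simplicial complex $\Sigma$ on vertex set $\{1,\dots,n\}$ together with a configuration $\mathbf p\in(\mathbb R^2)^n$. Two frameworks $(\Sigma,\mathbf p)$, $(\Sigma,\mathbf q)$ are equivalent if $\det C(\sigma,\mathbf p)=\det C(\sigma,\mathbf q)$ for every 2-simplex $\sigma$ of $\Sigma$ (signed areas), and congruent if $\det C(\sigma,\mathbf p)=\det C(\sigma,\mathbf q)$ for every triple $\sigma\subseteq\{1,\dots,n\}$. A framework is generic if the $2n$ coordinates of $\mathbf p$ are algebraically independent over $\mathbb Q$. A framework $(\Sigma,\mathbf p)$ is rigid if there is an open neighbourhood $U$ of $\mathbf p$ in $(\mathbb R^2)^n$ such that for every $\mathbf q\in U$, if $(\Sigma,\mathbf q)$ is equivalent to $(\Sigma,\mathbf p)$ then it is congruent to $(\Sigma,\mathbf p)$. It is globally rigid if it admits a single congruence class, i.e. every $\mathbf q\in(\mathbb R^2)^n$ with $(\Sigma,\mathbf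 q)$ equivalent to $(\Sigma,\mathbf p)$ is such that $(\Sigma,\mathbf q)$ is congruent to $(\Sigma,\mathbf p)$. $B_5$ is the pure 2-dimensional simplicial complex on $\{1,\dots,7\}$ whose 2-simplices are $\{1,i,i+1\}$ and $\{i,i+1,7\}$ for $2\le i\le 5$, together with $\{1,2,6\}$ and $\{2,6,7\}$. *)

(* Defs.v *)
From HB Require Import structures.
From mathcomp Require Import all_boot all_order all_algebra.
From mathcomp Require Import all_classical all_reals all_analysis.
From mathcomp Require Import -(notations) mpoly.

Set Implicit Arguments.
Unset Strict Implicit.
Unset Printing Implicit Defensive.

Import Order.TTheory GRing.Theory Num.Theory.
Import numFieldNormedType.Exports.

Local Open Scope classical_set_scope.
Local Open Scope ring_scope.

(* The vertex set {1, ..., n} is represented by 'I_n, the ordinal i standing  *)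
(* for the vertex i + 1. *)
Record complex2 (n : nat) := Complex2 {
  faces :> {set {set 'I_n}};
  faces_sub : forall S T : {set 'I_n},
    S \in faces -> T \subset S -> T \in faces;
  faces_vertex : forall i : 'I_n, [set i]%SET \in faces;
  faces_pure : forall S : {set 'I_n}, S \in faces ->
    exists T : {set 'I_n}, [/\ T \in faces, #|T| = 3%N & S \subset T]
}.

(* A configuration is a 2 x n matrix whose i-th column is the point p(i). *)
Notation config R n := 'M[R]_(2, n) (only parsing).

(* A triple i_1 < i_2 < i_3 is a strictly increasing map from 'I_3. *)
Definition triple (n : nat) (s : 'I_3 -> 'I_n) : Prop :=
  forall a b : 'I_3, (a < b)%N -> (s a < s b)%N.

Definition Cmx (R : realType) (n : nat) (s : 'I_3 -> 'I_n) (p : config R n) :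
    'M[R]_3 :=
  col_mx (const_mx 1 : 'rV[R]_3) (colsub s p : 'M[R]_(2, 3)).

Definition equivalent (R : realType) (n : nat) (Sigma : complex2 n)
    (p q : config R n) : Prop :=
  forall s : 'I_3 -> 'I_n, triple s -> [set s k | k : 'I_3]%SET \in faces Sigma ->
    \det (Cmx s p) = \det (Cmx s q).

Definition congruent (R : realType) (n : nat) (p q : config R n) : Prop :=
  forall s : 'I_3 -> 'I_n, triple s -> \det (Cmx s p) = \det (Cmx s q).

Definition alg_independent (R : realType) (m : nat) (x : 'I_m -> R) : Prop :=
  forall P : mpoly m rat,
    meval x (map_mpoly (@ratr R) P) = 0 -> P = 0.

Definition generic (R : realType) (n : nat) (p : config R n) : Prop :=
  alg_independent (fun k : 'I_(2 * n) => mxvec p ord0 k).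

Definition rigid (R : realType) (n : nat) (Sigma : complex2 n)
    (p : config R n) : Prop :=
  exists U : set (config R n), [/\ open U, U p &
    forall q, U q -> equivalent Sigma q p -> congruent q p].

Definition globally_rigid (R : realType) (n : nat) (Sigma : complex2 n)
    (p : config R n) : Prop :=
  forall q : config R n, equivalent Sigma q p -> congruent q p.

(* Vertices of B_5 under their labels 1, ..., 7. *)
Definition vtx (k : nat) : 'I_7 := inord k.-1.

Definition B5_triangles : seq {set 'I_7} :=
  ([seq [set vtx 1; vtx i; vtx i.+1] | i <- iota 2 4] ++
   [seq [set vtx i; vtx i.+1; vtx 7] | i <- iota 2 4] ++
   [:: [set vtx 1; vtx 2; vtx 6]; [set vtx 2; vtx 6; vtx 7]])%SET.

Definition B5_faces : {set {set 'I_7}} :=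
  [set S : {set 'I_7} | has (fun T : {set 'I_7} => S \subset T) B5_triangles]%SET.

Lemma vtxE (i : 'I_7) : i = vtx i.+1.
Proof. by rewrite /vtx inord_val. Qed.

Lemma vtx_eq (i j : nat) :
  (0 < i <= 7)%N -> (0 < j <= 7)%N -> (vtx i == vtx j) = (i == j).
Proof.
case: i j => [|i] [|j] //= Hi Hj.
by rewrite -val_eqE /= !inordK.
Qed.

Lemma B5_card3 (T : {set 'I_7}) : T \in B5_triangles -> #|T| = 3%N.
Proof.
rewrite !inE.
by do ![case/orP=> [/eqP->|]]; last move/eqP->;
  rewrite -finset.setUA cardsU1 cards2 !inE !vtx_eq.
Qed.

Lemma B5_sub (S T : {set 'I_7}) :
  S \in B5_faces -> T \subset S -> T \in B5_faces.
Proof.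
rewrite !inE => /hasP[U UB SU] TS; apply/hasP; exists U => //.
exact: fintype.subset_trans TS SU.
Qed.

Lemma B5_vertex (i : 'I_7) : [set i]%SET \in B5_faces.
Proof.
rewrite inE (vtxE i) /= !finset.sub1set !inE !vtx_eq ?ltn_ord //.
by case: i => -[|[|[|[|[|[|[|i]]]]]]].
Qed.

Lemma B5_pure (S : {set 'I_7}) : S \in B5_faces ->
  exists T : {set 'I_7}, [/\ T \in B5_faces, #|T| = 3%N & S \subset T].
Proof.
rewrite inE => /hasP[T TB ST]; exists T; split=> //; last exact: B5_card3.
by rewrite inE; apply/hasP; exists T.
Qed.

Definition B5 : complex2 7 := Complex2 B5_sub B5_vertex B5_pure.

(* Main.v *)
(** Write v_i = p(i) - p(1) and w = p(7) - p(1), with brackets denoting 2 x 2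
    determinants.  The ten areas of B_5 determine a_i = [v_i, v_(i+1)]
    along the equator and the differences of the x_i = [w, v_i].  An equivalent
    configuration therefore has the same a_i and spokes x_i + s for a single
    unknown s.  In coordinates with w = (1, 0), where v_i = (y_i, x_i),
    following the ratios y_i / x_i once around the equator gives
    sum_i a_i / ((x_i + s) (x_(i+1) + s)) = 0.  Clearing denominators, this is a
    cubic equation in s with the root s = 0; the cofactor is a quadratic
    polynomial.  If its discriminant is negative the framework is globally
    rigid; if it is positive another real root yields an equivalent,
    non-congruent framework, while simplicity of the root 0 gives rigidity.
    Both signs occur on nonempty open sets, and generic configurations are
    dense by Baire's theorem, since the zero set of each of the countably many
    nonzero rational polynomials is closed with empty interior. *)

From HB Require Import structures.
Require Import Defs.
From mathcomp Require Import all_boot all_order all_algebra.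
From mathcomp Require Import all_classical all_reals all_analysis.
From mathcomp Require Import -(notations) mpoly.
From mathcomp Require Import ring lra.

Set Implicit Arguments.
Unset Strict Implicit.
Unset Printing Implicit Defensive.

Import Order.TTheory GRing.Theory Num.Theory.
Import numFieldNormedType.Exports.

Local Open Scope classical_set_scope.
Local Open Scope ring_scope.

(* Makes matrices complete normed modules, as Baire's theorem requires. *)
HB.instance Definition _ (R : realType) (m n : nat) :=
  NormedModule.on 'M[R]_(m.+1, n.+1).

(** * Polynomials: nonvanishing on infinite grids, and countability over the rationals *)

Lemma infinite_nonroot (R : idomainType) (A : set R) (p : {poly R}) :
  infinite_set A -> p != 0 -> exists2 a, A a & p.[a] != 0.
Proof.
move=> Ainf p0; have [B BA sB] := infinite_set_fset (size p) Ainf.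
have [/allP allB|] := boolP (all (root p) (finmap.enum_fset B)).
  have /(max_poly_roots p0) : all (root p) (finmap.enum_fset B) by apply/allP.
  by rewrite finmap.fset_uniq => /(_ isT); rewrite ltnNge sB.
by case/allPn => a aB ra; exists a => //; exact: BA.
Qed.

Lemma lift_max_widen (n : nat) (i : 'I_n) :
  lift ord_max i = widen_ord (leqnSn n) i.
Proof. by apply/val_inj; exact: lift_max. Qed.

(** A monomial is determined by its last exponent together with the remaining ones, so distinct
    monomials of [p] cannot cancel when the last variable is singled out. *)
Lemma muni_neq0 (n : nat) (R : nzRingType) (p : mpoly n.+1 R) :
  p != 0 -> muni p != 0.
Proof.
apply: contra_neq => mp0; apply/mpolyP => m; rewrite mcoeff0.
have [mp|/memN_msupp_eq0//] := boolP (m \in msupp p).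
pose r (m' : multinom n.+1) : multinom n :=
  Multinom [tuple m' (widen_ord (leqnSn n) i) | i < n].
have /(congr1 (mcoeff (r m))) : (muni p)`_(m ord_max) = 0 by rewrite mp0 coef0.
rewrite muniE coef_sum raddf_sum /= mcoeff0 (bigD1_seq m) ?msupp_uniq //=.
rewrite coefZ coefXn eqxx mulr1 mcoeffZ mcoeffX eqxx mulr1 big1 ?addr0 //.
move=> m' neq; rewrite coefZ coefXn; case: eqP => [e1|];
  last by rewrite mulr0 mcoeff0.
rewrite mulr1 mcoeffZ mcoeffX; case: eqP => [e2|]; last by rewrite mulr0.
case/eqP: neq; apply/mnmP => i; case: (unliftP ord_max i) => [j ->|-> //].
rewrite lift_max_widen.
by have /(congr1 (fun m0 : multinom n => m0 j)) := e2; rewrite !mnmE.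
Qed.

Lemma meval_muni (n : nat) (R : comNzRingType) (v : 'I_n.+1 -> R)
    (p : mpoly n.+1 R) :
  meval v p =
  (map_poly (meval (fun i => v (widen_ord (leqnSn n) i))) (muni p)).[v ord_max].
Proof.
rewrite mevalE muniE rmorph_sum horner_sum /=; apply: eq_bigr => m _.
rewrite map_polyZ hornerZ map_polyXn hornerXn /= mevalZ mevalX big_ord_recr /=.
by rewrite mulrA; congr (_ * _ * _); apply: eq_bigr => i _; rewrite mnmE.
Qed.

(** Induction on the number of variables: the leading coefficient of [muni p] is nonzero at some
    point [v] of the smaller grid, and the univariate polynomial left there has finitely many
    roots. *)
Lemma meval_neq0_infinite (n : nat) (R : idomainType) (A : 'I_n -> set R)
    (p : mpoly n R) :
  (forall i, infinite_set (A i)) -> p != 0 ->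
  exists2 v, forall i, A i (v i) & meval v p != 0.
Proof.
elim: n A p => [|n IH] A p Ainf p0.
  exists (fun=> 0) => [[]//|]; apply: contra_neq p0 => ev.
  apply/mpolyP => m; rewrite mcoeff0.
  have m0 (m' : multinom 0) : m' = @mnm0 0 by apply/mnmP => -[].
  move: ev; rewrite (m0 m).
  have -> : p = mpolyC 0 (mcoeff (@mnm0 0) p).
    by apply/mpolyP => m'; rewrite mcoeffC (m0 m') eqxx mulr1.
  by rewrite mevalC mcoeffC eqxx mulr1.
have q0 := muni_neq0 p0.
have lq0 : lead_coef (muni p) != 0 by rewrite lead_coef_eq0.
have [v vA vq] := IH (fun i => A (widen_ord (leqnSn n) i)) _ (fun=> Ainf _) lq0.
have mq0 : map_poly (meval v) (muni p) != 0.
  by apply: contra_neq vq => e; rewrite /lead_coef -coef_map e coef0.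
have [a Aa qa] := infinite_nonroot (Ainf ord_max) mq0.
pose w i := oapp v a (unlift ord_max i).
have wmax : w ord_max = a by rewrite /w unlift_none.
have wwid i : w (widen_ord (leqnSn n) i) = v i.
  by rewrite /w -lift_max_widen liftK.
exists w.
  move=> i; case: (unliftP ord_max i) => [j ->|->]; last by rewrite wmax.
  by rewrite lift_max_widen wwid.
rewrite meval_muni wmax.
by under eq_map_poly do (under meval_eq do rewrite wwid).
Qed.

Lemma mpoly_rat_encoding (n : nat) : exists f : mpoly n rat -> nat, injective f.
Proof.
pose g (p : mpoly n rat) := [seq (m, mcoeff m p) | m <- msupp p].
exists (pickle \o g); apply: inj_comp; first exact: (pcan_inj pickleK).
move=> p q gpq; apply/mpolyP => m.
have unzip_g s : unzip1 (g s) = msupp s.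
  by rewrite /unzip1 -map_comp -[RHS]map_id; exact: eq_map.
have sup : msupp p = msupp q by rewrite -!unzip_g gpq.
have [mp|mp] := boolP (m \in msupp p); last first.
  by rewrite !memN_msupp_eq0 // -sup.
have : (m, mcoeff m p) \in g q by rewrite -gpq; apply/mapP; exists m.
by case/mapP => m' _ [-> ->].
Qed.

(** * Density of generic configurations *)

Lemma infinite_ball (R : realType) (x e : R) : 0 < e -> infinite_set (ball x e).
Proof.
move=> e0.
have /limit_point_infinite_setP/(_ _ (nbhsx_ballx _ _ e0)) : limit_point setT x.
  move=> U /nbhs_ballP[d /= d0 dU]; exists (x + d / 2); split=> //.
    by rewrite -subr_eq0 addrAC subrr add0r mulf_neq0 // gt_eqF // invr_gt0.
  apply: dU; rewrite /ball /= opprD addrA subrr add0r normrN gtr0_norm; lra.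
by rewrite setIT.
Qed.

Section GenericDense.
Variables (R : realType) (m n : nat).

Lemma mxvec_coord_continuous (k : 'I_(m * n)) :
  continuous (fun p : 'M[R]_(m, n) => mxvec p ord0 k).
Proof.
case/mxvec_indexP: k => i j.
have -> : (fun p : 'M[R]_(m, n) => mxvec p ord0 (mxvec_index i j)) =
          (fun p => p i j) by apply/funext => p; exact: mxvecE.
exact: coord_continuous.
Qed.

Lemma meval_mxvec_continuous (P : mpoly (m * n) R) :
  continuous (fun p : 'M[R]_(m, n) => meval (fun k => mxvec p ord0 k) P).
Proof.
rewrite (_ : (fun p => _) = fun p : 'M[R]_(m, n) => \sum_(d <- msupp P)
    mcoeff d P * \prod_k mxvec p ord0 k ^+ d k); last first.
  by apply/funext => p; exact: mevalE.
apply: continuous_big; first exact: add_continuous.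
move=> d _; have prodc : continuous
    (fun p : 'M[R]_(m, n) => \prod_k mxvec p ord0 k ^+ d k).
  apply: continuous_big; first exact: mul_continuous.
  move=> k _ p; apply: (@continuous_comp _ _ _
    (fun q : 'M[R]_(m, n) => mxvec q ord0 k) (fun x : R => x ^+ d k)).
    exact: mxvec_coord_continuous.
  exact: exprn_continuous.
by move=> p; apply: continuousM; [exact: cst_continuous|exact: prodc].
Qed.

End GenericDense.

Lemma generic_dense (R : realType) (n : nat) :
  dense (@generic R n.+1 : set 'M[R]_(2, n.+1)).
Proof.
have [f finj] := mpoly_rat_encoding (2 * n.+1).
pose ev (P : mpoly (2 * n.+1) rat) (p : 'M[R]_(2, n.+1)) :=
  meval (fun k => mxvec p ord0 k) (map_mpoly (@ratr R) P).
(* Indexing by codes turns the conditions into a sequence, as Baire's theorem requires; [F k] is the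
   whole space when [k] codes no nonzero polynomial. *)
pose F k : set 'M[R]_(2, n.+1) :=
  [set p | forall P, f P = k -> P != 0 -> ev P p != 0].
have FE k : F k = setT \/ exists2 P, P != 0 & F k = [set p | ev P p != 0].
  have [[P [fP P0]]|no] := pselect (exists P, f P = k /\ P != 0).
    right; exists P => //; apply/seteqP; split=> p /=; first exact.
    by move=> ep Q fQ _; rewrite (finj Q P) // fP.
  by left; rewrite -subTset => p _ P fP P0; case: no; exists P.
have Fok k : open (F k) /\ dense (F k).
  case: (FE k) => [->|[P P0 ->]].
    by split; [exact: openT|move=> O O0 _; rewrite setIT].
  split.
    apply: (@open_comp _ _ (ev P) [set x | x != 0]).
      by move=> p _; exact: meval_mxvec_continuous.
    exact: open_neq.
  move=> O [p Op]; rewrite openE => /(_ _ Op) /nbhs_ballP[e /= e0 eO].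
  have P'0 : map_mpoly (@ratr R) P != 0.
    apply: contra_neq P0 => /mpolyP P'0; apply/mpolyP => d.
    apply: (fmorph_inj (@ratr R)).
    by rewrite -mcoeff_map_mpoly P'0 !mcoeff0 rmorph0.
  (* A ball of matrices is a box, that is, a product of intervals around the entries of [p], and
     each interval is infinite. *)
  have [v vb vP] := meval_neq0_infinite
    (fun k => @infinite_ball R (mxvec p ord0 k) e e0) P'0.
  exists (vec_mx (\row_k v k)); split.
    apply: eO; split=> // i j; rewrite mxE mxE.
    by have := vb (mxvec_index i j); rewrite (mxvecE p i j : mxvec p ord0 _ = _).
  rewrite /= /ev; under meval_eq do rewrite vec_mxK mxE; exact: vP.
move=> O O0 oO; have [p [Op Fp]] := Baire Fok O0 oO.
exists p; split=> // P eP; apply/eqP; apply: contraT => P0.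
by have := Fp (f P) I P erefl P0; rewrite /ev eP eqxx.
Qed.

(** * Equivalence and congruence in terms of signed areas *)

Definition area (R : realType) (n : nat) (p : 'M[R]_(2, n)) (i j k : 'I_n) : R :=
  (p 0 j - p 0 i) * (p 1 k - p 1 i) - (p 1 j - p 1 i) * (p 0 k - p 0 i).

Lemma det_Cmx (R : realType) (n : nat) (s : 'I_3 -> 'I_n) (p : 'M[R]_(2, n)) :
  \det (Cmx s p) = area p (s 0) (s 1) (s 2).
Proof.
(* Factoring [s] through the natural numbers identifies ordinals that are written differently but
   have the same value. *)
pose t (k : nat) := s (inord k).
have tE j : s j = t j by rewrite /t inord_val.
clearbody t.
have CmxE i j : Cmx s p i j = nth 0 [:: 1; p 0 (t j); p 1 (t j)] i.
  rewrite -tE mxE; case: splitP => k ->; first by rewrite ord1 mxE.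
  by rewrite mxE; case: k => -[|[|//]] lk /=; congr (p _ _); apply/val_inj.
move: (Cmx s p) CmxE => M CmxE.
rewrite (expand_det_row _ ord0) !big_ord_recl big_ord0 /cofactor.
rewrite !(expand_det_row _ ord0) !big_ord_recl !big_ord0 /cofactor !det_mx11.
rewrite !mxE !CmxE /= /bump /=.
rewrite /area !tE /=; ring.
Qed.

Lemma ltn_triple (n : nat) (s : 'I_3 -> 'I_n) :
  triple s <-> (s 0%R < s 1%R < s 2%R)%N.
Proof.
split=> [ts|]; first by rewrite !ts.
pose t (k : nat) := s (inord k).
have tE j : s j = t j by rewrite /t inord_val.
clearbody t; rewrite !tE /= => /andP[t01 t12] a b; rewrite !tE.
case: a b => [[|[|[|//]]] la] [[|[|[|//]]] lb] //= _.
exact: ltn_trans t12.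
Qed.

Definition triple_of (n : nat) (i j k : 'I_n) (a : 'I_3) : 'I_n :=
  tnth [tuple i; j; k] a.

Lemma triple_of_image (n : nat) (i j k : 'I_n) :
  [set triple_of i j k a | a : 'I_3]%SET = [set i; j; k]%SET.
Proof.
apply/setP => x; rewrite !inE; apply/imsetP/idP.
  by case=> -[[|[|[|//]]] la] _ ->; rewrite /triple_of (tnth_nth i) /= eqxx ?orbT.
by case/orP=> [/orP[]|] /eqP ->; [exists 0|exists 1|exists 2];
  rewrite // /triple_of (tnth_nth i).
Qed.

Lemma image_triple (n : nat) (s : 'I_3 -> 'I_n) :
  [set s a | a : 'I_3]%SET = [set s 0; s 1; s 2]%SET.
Proof.
rewrite -triple_of_image; apply: eq_imset => -[[|[|[|//]]] la];
  by rewrite /triple_of (tnth_nth (s 0)) /=; congr s; apply/val_inj.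
Qed.

Lemma congruentP (R : realType) (n : nat) (p q : 'M[R]_(2, n)) :
  congruent p q <->
  forall i j k : 'I_n, (i < j < k)%N -> area p i j k = area q i j k.
Proof.
split=> [pq i j k ijk|pq s /ltn_triple s012]; last by rewrite !det_Cmx pq.
have := pq (triple_of i j k); rewrite !det_Cmx /triple_of !(tnth_nth i) /=.
by apply; apply/ltn_triple; rewrite !(tnth_nth i).
Qed.

Lemma equivalentP (R : realType) (n : nat) (S : complex2 n) (p q : 'M[R]_(2, n)) :
  equivalent S p q <->
  forall i j k : 'I_n, (i < j < k)%N -> [set i; j; k]%SET \in faces S ->
    area p i j k = area q i j k.
Proof.
split=> [pq i j k ijk ijkS|pq s /ltn_triple s012].
  have := pq (triple_of i j k); rewrite !det_Cmx /triple_of !(tnth_nth i) /=.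
  by apply; [apply/ltn_triple; rewrite !(tnth_nth i)|rewrite triple_of_image].
by rewrite image_triple !det_Cmx => /pq; apply.
Qed.

(** * The triangles of the bipyramid as increasing triples *)

Definition B5_triples : seq (nat * nat * nat) :=
  [:: (1, 2, 3); (1, 3, 4); (1, 4, 5); (1, 5, 6); (1, 2, 6);
      (2, 3, 7); (3, 4, 7); (4, 5, 7); (5, 6, 7); (2, 6, 7)]%N.

(** An increasing triple has three elements, so lying inside a triangle means being that triangle;
    the proof checks all cases. *)
Lemma B5_facesP (i j k : 'I_7) : (i < j < k)%N ->
  ([set i; j; k]%SET \in faces B5) = ((i.+1, j.+1, k.+1) \in B5_triples).
Proof.
have vE (x : 'I_7) a : (0 < a <= 7)%N -> (x == vtx a) = (x == a.-1 :> nat).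
  by case: a => // a Ha; rewrite -val_eqE /= inordK.
move=> ijk.
rewrite !inE /= !finset.subUset !finset.sub1set !inE !vE //=.
by case: i j k ijk => -[|[|[|[|[|[|[|//]]]]]]] ?
  [] [|[|[|[|[|[|[|//]]]]]]] ? [] [|[|[|[|[|[|[|//]]]]]]].
Qed.

Lemma B5_equivalentP (R : realType) (p q : 'M[R]_(2, 7)) :
  equivalent B5 p q <->
  forall a b c, (a, b, c) \in B5_triples ->
    area p (vtx a) (vtx b) (vtx c) = area q (vtx a) (vtx b) (vtx c).
Proof.
split=> [/equivalentP pq a b c abc|pq].
  have /and3P[a0 ab /andP[bc c7]] : [&& 0 < a, a < b, b < c & c <= 7]%N.
    have /allP/(_ _ abc) // : all (fun t : nat * nat * nat =>
      [&& 0 < t.1.1, t.1.1 < t.1.2, t.1.2 < t.2 & t.2 <= 7]%N) B5_triples by [].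
  case: a b c abc a0 ab bc c7 => [//|a] [//|b] [//|c] abc _ ab bc c7.
  have b7 : (b < 7)%N by apply: ltn_trans c7.
  have a7 : (a < 7)%N by apply: ltn_trans b7.
  have lt : (vtx a.+1 < vtx b.+1 < vtx c.+1)%N by rewrite !inordK //; apply/andP.
  by apply: pq => //; rewrite B5_facesP // !inordK.
apply/equivalentP => i j k ijk; rewrite B5_facesP // => /pq.
by rewrite -!vtxE.
Qed.

(** * Continuity of polynomial expressions, and open sign conditions *)

Section PolynomialContinuity.
Variables (R : realType) (m n : nat).
Implicit Types f g : 'M[R]_(m, n) -> R.

Lemma continuous_addf f g :
  continuous f -> continuous g -> continuous (fun x => f x + g x).
Proof. by move=> cf cg x; apply: continuousD; [exact: cf|exact: cg]. Qed.

Lemma continuous_oppf f : continuous f -> continuous (fun x => - f x).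
Proof. by move=> cf x; apply: continuousN; exact: cf. Qed.

Lemma continuous_mulf f g :
  continuous f -> continuous g -> continuous (fun x => f x * g x).
Proof. by move=> cf cg x; apply: continuousM; [exact: cf|exact: cg]. Qed.

Lemma continuous_expf f k : continuous f -> continuous (fun x => f x ^+ k).
Proof.
move=> cf x; apply: (@continuous_comp _ _ _ f (fun y : R => y ^+ k)).
  exact: cf.
exact: exprn_continuous.
Qed.

End PolynomialContinuity.

Lemma open_neq0 (R : realType) (T : topologicalType) (f : T -> R) :
  continuous f -> open [set x | f x != 0].
Proof.
move=> cf; apply: (@open_comp _ _ f [set x | x != 0]) => [x _|]; first exact: cf.
exact: open_neq.
Qed.

Lemma open_lt0 (R : realType) (T : topologicalType) (f : T -> R) :
  continuous f -> open [set x | f x < 0].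
Proof.
move=> cf; apply: (@open_comp _ _ f [set x | x < 0]) => [x _|]; first exact: cf.
exact: open_lt.
Qed.

Lemma open_gt0 (R : realType) (T : topologicalType) (f : T -> R) :
  continuous f -> open [set x | 0 < f x].
Proof.
move=> cf; apply: (@open_comp _ _ f [set x | 0 < x]) => [x _|]; first exact: cf.
exact: open_gt.
Qed.

(* A [leaf] that starts with a match needs a leading [idtac], so that it is not
   evaluated on the initial goal. *)
Ltac poly_continuous leaf :=
  lazymatch goal with
  | |- continuous (fun p => @?f p + @?g p) =>
      apply: (@continuous_addf _ _ _ f g); poly_continuous leaf
  | |- continuous (fun p => - @?f p) =>
      apply: (@continuous_oppf _ _ _ f); poly_continuous leaf
  | |- continuous (fun p => @?f p * @?g p) =>
      apply: (@continuous_mulf _ _ _ f g); poly_continuous leaf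
  | |- continuous (fun p => @?f p ^+ ?k) =>
      apply: (@continuous_expf _ _ _ f k); poly_continuous leaf
  | |- _ => leaf
  end.

(** * Rims, spokes and the closing equation *)

Section Bipyramid.
Variable R : realType.
Implicit Types (p q : 'M[R]_(2, 7)) (s : R).

(* With the apex 1 as origin, [rim p i j] is [v_i, v_j] and [spoke p i] is
   [w, v_i]. *)
Definition rim p (i j : nat) : R := area p (vtx 1) (vtx i) (vtx j).
Definition spoke p (i : nat) : R := area p (vtx 1) (vtx 7) (vtx i).

Lemma rimC p i j : rim p i j = - rim p j i.
Proof. rewrite /rim /area; ring. Qed.

Lemma rim7 p i : rim p i 7 = - spoke p i.
Proof. exact: rimC. Qed.

Lemma area_rim p i j k :
  area p (vtx i) (vtx j) (vtx k) = rim p i j + rim p j k - rim p i k.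
Proof. rewrite /rim /area; ring. Qed.

(** The three-term Plücker relation for the vectors [w], [v_i], [v_j], [v_k]; when the spoke at [j]
    is nonzero it recovers [rim p i k] from the rims at [j]. *)
Lemma rim_plucker p i j k :
  spoke p j * rim p i k = spoke p k * rim p i j + spoke p i * rim p j k.
Proof. rewrite /spoke /rim /area; ring. Qed.

(* Coefficients of the cofactor of s in [closing p s] below. *)
Definition quadA p : R :=
  rim p 2 3 + rim p 3 4 + rim p 4 5 + rim p 5 6 + rim p 6 2.

Definition quadB p : R :=
  rim p 2 3 * (spoke p 4 + spoke p 5 + spoke p 6) +
  rim p 3 4 * (spoke p 5 + spoke p 6 + spoke p 2) +
  rim p 4 5 * (spoke p 6 + spoke p 2 + spoke p 3) +
  rim p 5 6 * (spoke p 2 + spoke p 3 + spoke p 4) +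
  rim p 6 2 * (spoke p 3 + spoke p 4 + spoke p 5).

Definition quadC p : R :=
  let e2 (x y z : R) := x * y + y * z + z * x in
  rim p 2 3 * e2 (spoke p 4) (spoke p 5) (spoke p 6) +
  rim p 3 4 * e2 (spoke p 5) (spoke p 6) (spoke p 2) +
  rim p 4 5 * e2 (spoke p 6) (spoke p 2) (spoke p 3) +
  rim p 5 6 * e2 (spoke p 2) (spoke p 3) (spoke p 4) +
  rim p 6 2 * e2 (spoke p 3) (spoke p 4) (spoke p 5).

Definition quad p s : R := quadA p * s ^+ 2 + quadB p * s + quadC p.
Definition disc p : R := quadB p ^+ 2 - 4 * quadA p * quadC p.

(* The cyclic sum of a_i / ((x_i + s) (x_(i+1) + s)), denominators cleared. *)
Definition closing p s : R :=
  rim p 2 3 * (spoke p 4 + s) * (spoke p 5 + s) * (spoke p 6 + s) +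
  rim p 3 4 * (spoke p 5 + s) * (spoke p 6 + s) * (spoke p 2 + s) +
  rim p 4 5 * (spoke p 6 + s) * (spoke p 2 + s) * (spoke p 3 + s) +
  rim p 5 6 * (spoke p 2 + s) * (spoke p 3 + s) * (spoke p 4 + s) +
  rim p 6 2 * (spoke p 3 + s) * (spoke p 4 + s) * (spoke p 5 + s).

(** Divided by the product of the spokes, the sum telescopes around the equator, each term being a
    difference of consecutive ratios [y_i / x_i]; the cleared identity is polynomial and holds for
    zero spokes too. *)
Lemma closing0 p : closing p 0 = 0.
Proof. rewrite /closing /rim /spoke /area; ring. Qed.

Lemma closing_quad p s : closing p s = s * quad p s.
Proof.
(* Subtracting [closing p 0] removes the constant term; what remains is formal in the rims and
   spokes. *)
rewrite -[LHS]subr0 -(closing0 p) /quad /closing /quadA /quadB /quadC; ring.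
Qed.

(** * Equivalent configurations: the common shift of the spokes *)

Lemma B5_equivalent_rim p q : equivalent B5 q p ->
  [/\ rim q 2 3 = rim p 2 3, rim q 3 4 = rim p 3 4, rim q 4 5 = rim p 4 5,
      rim q 5 6 = rim p 5 6 & rim q 6 2 = rim p 6 2].
Proof.
move=> /B5_equivalentP qp; split; try exact: qp.
by rewrite rimC [RHS]rimC; congr (- _); exact: qp.
Qed.

Definition spoke_shift p q : R := spoke q 2 - spoke p 2.

(** Given the rims, each triangle [i], [i+1], 7 fixes the difference of two consecutive spokes. *)
Lemma B5_equivalent_spoke p q : equivalent B5 q p ->
  forall i, (2 <= i <= 6)%N -> spoke q i = spoke p i + spoke_shift p q.
Proof.
move=> eqp; have [e23 e34 e45 e56 e62] := B5_equivalent_rim eqp.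
move: eqp => /B5_equivalentP qp.
have e i j : (i, j, 7%N) \in B5_triples ->
    rim q i j - spoke q j + spoke q i = rim p i j - spoke p j + spoke p i.
  by move=> /qp; rewrite !area_rim !rim7 !opprK.
have := (e 2%N 3%N isT, e 3%N 4%N isT, e 4%N 5%N isT, e 5%N 6%N isT).
rewrite e23 e34 e45 e56 => -[[[f23 f34] f45] f56].
case=> [|[|[|[|[|[|[|//]]]]]]] // _; rewrite /spoke_shift; lra.
Qed.

(** The identity [closing0] for [q], written in the rims and shifted spokes of [p], is the closing
    equation of [p] at the shift. *)
Lemma B5_equivalent_shift p q : equivalent B5 q p ->
  spoke_shift p q * quad p (spoke_shift p q) = 0.
Proof.
move=> eqp; have [e23 e34 e45 e56 e62] := B5_equivalent_rim eqp.
have es := B5_equivalent_spoke eqp.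
rewrite -closing_quad -[RHS](closing0 q) /closing.
by rewrite e23 e34 e45 e56 e62 !es // !addr0.
Qed.

Definition spokes_neq0 p := forall i, (2 <= i <= 6)%N -> spoke p i != 0.

(** Two nonadjacent vertices of the equatorial pentagon have a common neighbour, so the Plücker
    relation, divided by the spoke there, carries the equality from edges to diagonals. *)
Lemma B5_congruent p q : spokes_neq0 p -> equivalent B5 q p ->
  spoke_shift p q = 0 -> congruent q p.
Proof.
move=> p0 eqp s0; have [e23 e34 e45 e56 e62] := B5_equivalent_rim eqp.
have es i : (2 <= i <= 6)%N -> spoke q i = spoke p i.
  by move=> /(B5_equivalent_spoke eqp) ->; rewrite s0 addr0.
have eskip i j k : (2 <= i <= 6)%N -> (2 <= j <= 6)%N -> (2 <= k <= 6)%N ->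
    rim q i j = rim p i j -> rim q j k = rim p j k -> rim q i k = rim p i k.
  move=> i26 j26 k26 eij ejk; apply: (mulfI (p0 j j26)).
  by rewrite -[in LHS](es j j26) [LHS]rim_plucker [RHS]rim_plucker !es // eij ejk.
have e24 := eskip 2 3 4 isT isT isT e23 e34.
have e35 := eskip 3 4 5 isT isT isT e34 e45.
have e46 := eskip 4 5 6 isT isT isT e45 e56.
have e52 := eskip 5 6 2 isT isT isT e56 e62.
have e63 := eskip 6 2 3 isT isT isT e62 e23.
have rev i j : rim q j i = rim p j i -> rim q i j = rim p i j.
  by move=> eji; rewrite rimC eji -rimC.
have rim1 r k : rim r 1 k = 0 by rewrite /rim /area; ring.
have erim i j : (0 < i < j)%N -> (j <= 7)%N -> rim q i j = rim p i j.
  case: i j => [|[|[|[|[|[|[|[|i]]]]]]]] [|[|[|[|[|[|[|[|j]]]]]]]] // _ _;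
    by [rewrite !rim1|rewrite !rim7 es|assumption|apply: rev].
apply/congruentP => i j k /andP[ij jk]; have ik := ltn_trans ij jk.
by rewrite (vtxE i) (vtxE j) (vtxE k) !area_rim !erim //= ltn_ord.
Qed.

Lemma B5_globally_rigid p :
  spokes_neq0 p -> disc p < 0 -> globally_rigid B5 p.
Proof.
move=> p0 dp q eqp; apply: (B5_congruent p0 eqp).
have /eqP := B5_equivalent_shift eqp; rewrite mulf_eq0 => /orP[/eqP//|/eqP q0].
(* Completing the square: at a root of [quad p], the discriminant would equal this square. *)
have : 0 <= (2 * quadA p * spoke_shift p q + quadB p) ^+ 2 by rewrite sqr_ge0.
have -> : (2 * quadA p * spoke_shift p q + quadB p) ^+ 2 =
    4 * quadA p * quad p (spoke_shift p q) + disc p by rewrite /quad /disc; ring.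
by rewrite q0 mulr0 add0r leNgt dp.
Qed.

(** * Continuity of the coefficients, and rigidity *)

Lemma spoke_continuous i : continuous (fun p : 'M[R]_(2, 7) => spoke p i).
Proof. rewrite /spoke /area; poly_continuous ltac:(exact: coord_continuous). Qed.

Lemma rim_continuous i j : continuous (fun p : 'M[R]_(2, 7) => rim p i j).
Proof. rewrite /rim /area; poly_continuous ltac:(exact: coord_continuous). Qed.

Lemma quadA_continuous : continuous quadA.
Proof. by rewrite /quadA; poly_continuous ltac:(exact: rim_continuous). Qed.

Lemma quadB_continuous : continuous quadB.
Proof.
rewrite /quadB; poly_continuous ltac:(idtac; lazymatch goal with
  | |- context [rim] => exact: rim_continuous
  | |- _ => exact: spoke_continuous end).
Qed.

Lemma quadC_continuous : continuous quadC.
Proof.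
rewrite /quadC; poly_continuous ltac:(idtac; lazymatch goal with
  | |- context [rim] => exact: rim_continuous
  | |- _ => exact: spoke_continuous end).
Qed.

Lemma quad_continuous (f : 'M[R]_(2, 7) -> R) :
  continuous f -> continuous (fun p => quad p (f p)).
Proof.
move=> cf; rewrite /quad.
poly_continuous ltac:(idtac; lazymatch goal with
  | |- context [quadA] => exact: quadA_continuous
  | |- context [quadB] => exact: quadB_continuous
  | |- context [quadC] => exact: quadC_continuous
  | |- _ => exact: cf end).
Qed.

Lemma disc_continuous : continuous disc.
Proof.
rewrite /disc.
poly_continuous ltac:(idtac; lazymatch goal with
  | |- context [quadA] => exact: quadA_continuous
  | |- context [quadB] => exact: quadB_continuous
  | |- context [quadC] => exact: quadC_continuous
  | |- _ => exact: cst_continuous end).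
Qed.

Lemma quad_shift_continuous p : continuous (fun q => quad p (spoke_shift p q)).
Proof.
rewrite /quad /spoke_shift.
poly_continuous ltac:(idtac; lazymatch goal with
  | |- continuous (fun q => spoke q _) => exact: spoke_continuous
  | |- _ => exact: cst_continuous end).
Qed.

(** At [p] the shift is 0 and [quad p 0] is [quadC p]; nearby, [quad p] stays nonzero at the shift,
    so an equivalent configuration must have shift 0. *)
Lemma B5_rigid p : spokes_neq0 p -> quadC p != 0 -> rigid B5 p.
Proof.
move=> p0 C0; exists [set q | quad p (spoke_shift p q) != 0]; split.
- exact/open_neq0/quad_shift_continuous.
- by rewrite /= /quad /spoke_shift subrr expr0n /= !mulr0 !add0r.
move=> q /= qs0 eqp; apply: (B5_congruent p0 eqp).
by have /eqP := B5_equivalent_shift eqp; rewrite mulf_eq0 (negbTE qs0) orbF => /eqP.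
Qed.

(** * Realising a nonzero shift *)

(* [l] lists the seven points in the order of their labels. *)
Definition config_of (l : seq (R * R)) : 'M[R]_(2, 7) :=
  \matrix_(i, j) (if i == 0 then (nth (0, 0) l j).1 else (nth (0, 0) l j).2).

Lemma area_config_of l a b c : (a < 7)%N -> (b < 7)%N -> (c < 7)%N ->
  let u := nth (0, 0) l a in let v := nth (0, 0) l b in
  let w := nth (0, 0) l c in
  area (config_of l) (vtx a.+1) (vtx b.+1) (vtx c.+1) =
  (v.1 - u.1) * (w.2 - u.2) - (v.2 - u.2) * (w.1 - u.1).
Proof. by move=> a7 b7 c7; rewrite /area !mxE !inordK. Qed.

(** A converse to [B5_equivalent_shift]; the nonzero shifted spokes are the denominators of the
    construction. *)
Lemma B5_realize p s : (forall i, (2 <= i <= 6)%N -> spoke p i + s != 0) ->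
  closing p s = 0 -> exists2 q, equivalent B5 q p & spoke_shift p q = s.
Proof.
move=> nz; rewrite /closing.
have := (nz 2%N isT, nz 3%N isT, nz 4%N isT, nz 5%N isT, nz 6%N isT).
set x2 := spoke p 2 + s; set x3 := spoke p 3 + s; set x4 := spoke p 4 + s.
set x5 := spoke p 5 + s; set x6 := spoke p 6 + s.
move=> [[[[x2_0 x3_0] x4_0] x5_0] x6_0] cl.
(* Normalise w = (1, 0) and v_2 = (0, x_2); the areas along the equator then
   determine the first coordinates one after the other, and [closing p s = 0]
   says that the walk closes up. *)
pose y3 := - rim p 2 3 / x2.
pose y4 := (y3 * x4 - rim p 3 4) / x3.
pose y5 := (y4 * x5 - rim p 4 5) / x4.
pose y6 := (y5 * x6 - rim p 5 6) / x5.
(* Multiplied by [x3 * x4 * x5], the difference of the two sides is minus the left side of [cl]. *)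
have y6E : y6 * x2 = rim p 6 2.
  rewrite /y6 /y5 /y4 /y3.
  apply: (mulfI (mulf_neq0 (mulf_neq0 x3_0 x4_0) x5_0)).
  apply/eqP; rewrite -subr_eq0 -oppr_eq0 -[X in _ == X]cl; apply/eqP.
  field; by rewrite x2_0 x3_0 x4_0 x5_0.
pose q := config_of [:: (0, 0); (0, x2); (y3, x3); (y4, x4); (y5, x5); (y6, x6);
  (1, 0)].
exists q; last first.
  rewrite /spoke_shift {1}/spoke /q area_config_of //= /x2; ring.
apply/B5_equivalentP => a b c; rewrite !inE => abc.
have r1 k : rim p 1 k = 0 by rewrite /rim /area; ring.
have r26 : rim p 2 6 = - (y6 * x2) by rewrite y6E; exact: rimC.
have r23 : rim p 2 3 = - (x2 * y3) by rewrite /y3; field.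
have r34 : rim p 3 4 = y3 * x4 - x3 * y4 by rewrite /y4; field.
have r45 : rim p 4 5 = y4 * x5 - x4 * y5 by rewrite /y5; field.
have r56 : rim p 5 6 = y5 * x6 - x5 * y6 by rewrite /y6; field.
(* The rims of [p] are now polynomials in the new coordinates, so forgetting the quotients leaves
   identities for [ring]. *)
clearbody y3 y4 y5 y6.
by move: abc; do ![case/orP] => /eqP[-> -> ->];
  rewrite /q area_config_of //= area_rim ?r1 ?rim7 ?r26 ?r23 ?r34 ?r45 ?r56
    /x2 /x3 /x4 /x5 /x6; ring.
Qed.

Lemma quad_root p : quadA p != 0 -> 0 < disc p -> exists s, quad p s = 0.
Proof.
move=> A0 d0; exists ((- quadB p + Num.sqrt (disc p)) / (2 * quadA p)).
have : Num.sqrt (disc p) ^+ 2 = disc p by rewrite sqr_sqrtr // ltW.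
set r := Num.sqrt _; rewrite /disc /quad => r2.
have -> : quadA p * ((- quadB p + r) / (2 * quadA p)) ^+ 2 +
    quadB p * ((- quadB p + r) / (2 * quadA p)) + quadC p =
    (r ^+ 2 - (quadB p ^+ 2 - 4 * quadA p * quadC p)) / (4 * quadA p) by field.
by rewrite r2 subrr mul0r.
Qed.

(** The first hypothesis keeps a root [s] of [quad p] from annihilating a shifted spoke, and
    [quadC p != 0] makes [s] nonzero. The nonface 1, 2, 7, whose area is minus the spoke at 2, then
    detects the change. *)
Lemma B5_not_globally_rigid p :
  (forall i, (2 <= i <= 6)%N -> quad p (- spoke p i) != 0) ->
  quadA p != 0 -> quadC p != 0 -> 0 < disc p -> ~ globally_rigid B5 p.
Proof.
move=> qs A0 C0 d0 gp; have [s qs0] := quad_root A0 d0.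
have [||q eqp sq] := @B5_realize p s.
- move=> i /qs; apply: contra_neq => e; rewrite -[RHS]qs0; congr quad.
  by apply/eqP; rewrite eq_sym -addr_eq0 addrC e.
- by rewrite closing_quad qs0 mulr0.
have /congruentP/(_ (vtx 1) (vtx 2) (vtx 7)) := gp q eqp.
rewrite /= !inordK // => /(_ isT); rewrite -!/(rim _ _ _) !rim7 => /oppr_inj e.
have s0 : s = 0 by rewrite -sq /spoke_shift e subrr.
by move/eqP: C0; apply; rewrite -qs0 s0 /quad expr0n /= !mulr0 !add0r.
Qed.

End Bipyramid.

Theorem corollary5p3 (R : realType) :
  (exists p : 'M[R]_(2, 7), [/\ generic p, rigid B5 p & globally_rigid B5 p]) /\
  (exists p' : 'M[R]_(2, 7),
    [/\ generic p', rigid B5 p' & ~ globally_rigid B5 p']).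
Proof.
(* A single product turns five nonvanishing conditions into one open condition. *)
pose spokes (p : 'M[R]_(2, 7)) :=
  spoke p 2 * spoke p 3 * spoke p 4 * spoke p 5 * spoke p 6.
have spokesP p : spokes p != 0 -> spokes_neq0 p.
  rewrite /spokes !mulf_eq0 !negb_or => /andP[/andP[/andP[/andP[? ?] ?] ?] ?].
  by case=> [|[|[|[|[|[|[|i]]]]]]].
have spokes_cont : continuous spokes.
  by rewrite /spokes; poly_continuous ltac:(exact: spoke_continuous).
split.
  pose U : set 'M[R]_(2, 7) := [set p | disc p < 0] `&` [set p | spokes p != 0].
  have oU : open U.
    by apply: openI; [exact/open_lt0/disc_continuous|exact: open_neq0].
  have [|p [[dp sp] gp]] := @generic_dense R 6 U _ oU.
    (* A rational point showing that [U] is nonempty: here [quad c s] is [- (s ^+ 2 + 2 * s + 3)],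
       with discriminant -8. As [w = (1, 0)], the spokes are the second coordinates. *)
    pose c := @config_of R [:: (0, 0); (1, 1); (0, 2); (1, 2); (-1, -1); (0, 1);
      (1, 0)].
    have s2 : spoke c 2 = 1 by rewrite /spoke area_config_of //=; ring.
    have s3 : spoke c 3 = 2 by rewrite /spoke area_config_of //=; ring.
    have s4 : spoke c 4 = 2 by rewrite /spoke area_config_of //=; ring.
    have s5 : spoke c 5 = - 1 by rewrite /spoke area_config_of //=; ring.
    have s6 : spoke c 6 = 1 by rewrite /spoke area_config_of //=; ring.
    have r23 : rim c 2 3 = 2 by rewrite /rim area_config_of //=; ring.
    have r34 : rim c 3 4 = - 2 by rewrite /rim area_config_of //=; ring.
    have r45 : rim c 4 5 = 1 by rewrite /rim area_config_of //=; ring.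
    have r56 : rim c 5 6 = - 1 by rewrite /rim area_config_of //=; ring.
    have r62 : rim c 6 2 = - 1 by rewrite /rim area_config_of //=; ring.
    have cA : quadA c = - 1 by rewrite /quadA r23 r34 r45 r56 r62; ring.
    have cB : quadB c = - 2.
      by rewrite /quadB r23 r34 r45 r56 r62 s2 s3 s4 s5 s6; ring.
    have cC : quadC c = - 3.
      by rewrite /quadC r23 r34 r45 r56 r62 s2 s3 s4 s5 s6; ring.
    exists c; split; first by rewrite /= /disc cA cB cC; lra.
    by rewrite /= /spokes s2 s3 s4 s5 s6; lra.
  have /spokesP p0 := sp.
  have grp : globally_rigid B5 p := B5_globally_rigid p0 dp.
  (* Global rigidity gives rigidity with the whole space as neighbourhood. *)
  exists p; split=> //; exists setT; split=> //; first exact: openT.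
  by move=> q _; exact: grp.
pose quads (p : 'M[R]_(2, 7)) := quad p (- spoke p 2) * quad p (- spoke p 3) *
  quad p (- spoke p 4) * quad p (- spoke p 5) * quad p (- spoke p 6).
have quadsP p : quads p != 0 ->
    forall i, (2 <= i <= 6)%N -> quad p (- spoke p i) != 0.
  rewrite /quads !mulf_eq0 !negb_or => /andP[/andP[/andP[/andP[? ?] ?] ?] ?].
  by case=> [|[|[|[|[|[|[|i]]]]]]].
have quads_cont : continuous quads.
  by rewrite /quads; poly_continuous
    ltac:(exact/quad_continuous/continuous_oppf/spoke_continuous).
pose nondeg (p : 'M[R]_(2, 7)) := quadA p * quadC p * spokes p * quads p.
have nondeg_cont : continuous nondeg.
  rewrite /nondeg; apply: continuous_mulf; last exact: quads_cont.
  apply: continuous_mulf; last exact: spokes_cont.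
  by apply: continuous_mulf; [exact: quadA_continuous|exact: quadC_continuous].
pose U : set 'M[R]_(2, 7) := [set p | 0 < disc p] `&` [set p | nondeg p != 0].
have oU : open U.
  by apply: openI; [exact/open_gt0/disc_continuous|exact: open_neq0].
have [|p [[dp np] gp]] := @generic_dense R 6 U _ oU.
  (* Here [quad c s] is [- s ^+ 2 + 2 * s + 5], with discriminant 24, and no negated spoke is a
     root. *)
  pose c := @config_of R [:: (0, 0); (0, 1); (0, 2); (1, 2); (0, -1); (1, 1);
    (1, 0)].
  have s2 : spoke c 2 = 1 by rewrite /spoke area_config_of //=; ring.
  have s3 : spoke c 3 = 2 by rewrite /spoke area_config_of //=; ring.
  have s4 : spoke c 4 = 2 by rewrite /spoke area_config_of //=; ring.
  have s5 : spoke c 5 = - 1 by rewrite /spoke area_config_of //=; ring.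
  have s6 : spoke c 6 = 1 by rewrite /spoke area_config_of //=; ring.
  have r23 : rim c 2 3 = 0 by rewrite /rim area_config_of //=; ring.
  have r34 : rim c 3 4 = - 2 by rewrite /rim area_config_of //=; ring.
  have r45 : rim c 4 5 = - 1 by rewrite /rim area_config_of //=; ring.
  have r56 : rim c 5 6 = 1 by rewrite /rim area_config_of //=; ring.
  have r62 : rim c 6 2 = 1 by rewrite /rim area_config_of //=; ring.
  have cA : quadA c = - 1 by rewrite /quadA r23 r34 r45 r56 r62; ring.
  have cB : quadB c = 2.
    by rewrite /quadB r23 r34 r45 r56 r62 s2 s3 s4 s5 s6; ring.
  have cC : quadC c = 5.
    by rewrite /quadC r23 r34 r45 r56 r62 s2 s3 s4 s5 s6; ring.
  have cn : nondeg c = 4320.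
    by rewrite /nondeg /spokes /quads /quad cA cB cC s2 s3 s4 s5 s6; ring.
  exists c; split; first by rewrite /= /disc cA cB cC; lra.
  by rewrite /= cn pnatr_eq0.
move: np; rewrite /= /nondeg 3!mulf_eq0 !negb_or.
move=> /andP[/andP[/andP[A0 C0] /spokesP p0] /quadsP q0].
exists p; split=> //; first exact: B5_rigid.
exact: B5_not_globally_rigid.
Qed.
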